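(* Let $(X,r)$ be an indecomposable solution of size $|X|=2d$, with $d$ odd, and $T$-partition $(2a,b,c)$, where $a,b,c$ are positive integers with $\gcd(2d,abc)=1$ and $b\leq c$. Then $2a+b=c$.
   Context: A solution $(X,r)$ is a non-empty finite set $X$, with $|X|>1$, together with an involutive map $r\colon X\times X\to X\times X$, $r(x,y)=(\sigma_x(y),\tau_y(x))$, satisfying $r_1r_2r_1=r_2r_1r_2$ on $X^3$, where $r_1=r\times \mathrm{Id}_X$ and $r_2=\mathrm{Id}_X\times r$, and such that all maps $\sigma_x$ and $\tau_x$ ($x\in X$) are bijections of $X$. A solution is decomposable if $X=Y\sqcup Z$ with $Y,Z$ non-empty and disjoint, $r(Y\times Y)=Y\times Y$ and $r(Z\times Z)=Z\times Z$; equivalently, if the permutation group $\mathcal{G}(X,r)$ generated by all $\sigma_x$, $x\in X$, does not act transitively on $X$. Otherwise it is indecomposable. The diagonal map of $(X,r)$ is the permutation $T\colon X\to X$, $T(x)=\tau_x^{-1}(x)$. The $T$-partition of $(X,r)$ is the partition of the integer $|X|$ given by the multiset of sizes of the $T$-orbits in $X$ (fixed points counted as orbits of size $1$; the order of the terms is irrelevant). *)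

(* Defs.v *)
From mathcomp Require Import all_boot fingroup perm.

Set Implicit Arguments.
Unset Strict Implicit.
Unset Printing Implicit Defensive.

Section Braiding.
Variables (X : Type) (r : X * X -> X * X).

Definition r12 (t : X * X * X) : X * X * X :=
  let: (x, y, z) := t in let: (u, v) := r (x, y) in (u, v, z).

Definition r23 (t : X * X * X) : X * X * X :=
  let: (x, y, z) := t in let: (u, v) := r (y, z) in (x, u, v).

End Braiding.

(* [r (x, y) = (sigma_x y, tau_y x)]: [tau] is indexed by the second
   argument of [r]. *)
Record solution (X : finType) := Solution {
  solution_map :> X * X -> X * X;
  solution_card : 1 < #|X|;
  solution_invol : involutive solution_map;
  solution_braid : forall t : X * X * X,
    r12 solution_map (r23 solution_map (r12 solution_map t)) =
    r23 solution_map (r12 solution_map (r23 solution_map t));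
  solution_sigma_bij : forall x, bijective (fun y => (solution_map (x, y)).1);
  solution_tau_bij : forall y, bijective (fun x => (solution_map (x, y)).2)
}.

Section Solution.
Variables (X : finType) (r : solution X).

Definition sigma (x : X) : {perm X} :=
  perm (bij_inj (solution_sigma_bij r x)).

Definition tau (y : X) : {perm X} :=
  perm (bij_inj (solution_tau_bij r y)).

Lemma solutionE x y : r (x, y) = (sigma x y, tau y x).
Proof. by rewrite !permE -surjective_pairing. Qed.

Definition decomposable : Prop :=
  exists Y Z : {set X},
    [/\ Y != set0 /\ Z != set0, [disjoint Y & Z], Y :|: Z = [set: X],
        r @: setX Y Y = setX Y Y & r @: setX Z Z = setX Z Z].

Definition indecomposable : Prop := ~ decomposable.

Definition diag_fun (x : X) : X := (tau x)^-1%g x.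

Lemma sigma_diag x : sigma (diag_fun x) x = diag_fun x.
Proof.
set y := diag_fun x.
have tau_y : tau x y = x by rewrite /y /diag_fun permKV.
have := solution_invol r (y, x).
rewrite !solutionE tau_y => -[_ tau_z].
by apply: (@perm_inj _ (tau x)); rewrite tau_z tau_y.
Qed.

Lemma diag_inj : injective diag_fun.
Proof.
move=> x y exy; apply: (@perm_inj _ (sigma (diag_fun x))).
by rewrite sigma_diag exy sigma_diag.
Qed.

Definition diag : {perm X} := perm diag_inj.

(* A multiset: the order of the terms comes from the enumeration of [{set X}]
   and is meaningful only up to [perm_eq]. [porbits] contains the fixed points
   as singletons. *)
Definition T_partition : seq nat :=
  [seq #|A| | A : {set X} <- enum (porbits diag)].

End Solution.

(* Main.v *)
Require Import Defs.
From mathcomp Require Import all_boot fingroup perm.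
From mathcomp Require Import automorphism action cyclic pgroup nilpotent sylow zify.

Set Implicit Arguments.
Unset Strict Implicit.
Unset Printing Implicit Defensive.

(** Write G for the permutation group of r, generated by the sigma_x, and T for
the diagonal map. The proof finds a subset O of X of size d that is stable under
some power T^k with k a power of 2, and then compares sizes.

The group G carries a second, abelian, group law, for which adding (the class
of) x to g gives g o sigma_y with y = g^-1 x. All that is used of it are the
translations g |-> g + x. They make sense on all of Sym(X) ([add_gen]), they
are injective because T turns (g + x)^-1 x into g^-1 x ([add_gen_inj]), and
they commute by the braid relation ([transl_comm]). They generate an abelian group A of permutations of
Sym(X) ([transl_group]). The regular representation of Sym(X) permutes the
generators of A ([translJ]), hence normalises A and its characteristic
subgroups; therefore the orbit of 1 under A or under O_pi(A) is a subgroup of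
Sym(X) ([orbit1_group_set]). The first orbit is G, and as A is abelian the
second one is a Hall pi-subgroup of G ([hall_group_Hall]). This is how
commutativity of the addition yields a Hall 2'-subgroup Q of G that is tied to
the solution.

Indecomposability makes G transitive on the 2d points of X, so the size of
every Q-orbit is a multiple of the odd number d; it also divides
#|Q|, hence is odd, and only d remains ([card_odd_hall_orbit]). On the other
hand the inverse of the k-fold sum of x is an element of G that sends x to
T^-k(x) ([diag_translX]). When k is the 2-part of #|A|, this sum lies in Q, so
T^k preserves every Q-orbit O ([diagX_hall_orbit]).

Finally let C be a T-orbit. Since k is a power of 2, every T^k-orbit in C has
size divisible by the odd part of #|C|, so #|O :&: C| is 0, a or 2a for the
orbit of size 2a, 0 or b, and 0 or c for the other two. These three numbers add
up to d, which is half of 2a + b + c. By parity and b <= c, the orbit of size c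
is one of the two halves and the other two T-orbits form the other half. *)

(** * Orbits of Hall subgroups and of powers of a permutation *)

Section Orbits.

Local Open Scope group_scope.

(** The stabiliser of x in H is a pi-group inside the stabiliser in K, so its
order divides the pi-part of the latter; compare the two orbit-stabiliser
formulas. *)
Lemma dvdn_card_orbit_Hall (aT : finGroupType) (T : finType)
    (to : {action aT &-> T}) (pi : nat_pred) (K H : {group aT}) (x : T) :
  pi.-Hall(K) H -> #|orbit to K x|`_pi %| #|orbit to H x|.
Proof.
move=> hallH; have [sHK piH _] := and3P hallH.
have sub_stab : 'C_H[x | to] \subset 'C_K[x | to] by apply: setSI.
have pi_stab : pi.-nat #|'C_H[x | to]| := pgroupS (subsetIl _ _) piH.
have /dvdnP[q Dq] : #|'C_H[x | to]| %| #|'C_K[x | to]|`_pi.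
  by rewrite -(part_pnat_id pi_stab) partn_dvd ?cardSg.
have := card_Hall hallH.
rewrite -(card_orbit_stab to K x) -(card_orbit_stab to H x) partnM ?cardG_gt0 //;
  last by rewrite card_orbit indexg_gt0.
rewrite Dq mulnA => /eqP; rewrite eqn_pmul2r ?cardG_gt0 // => /eqP->.
exact: dvdn_mulr.
Qed.

Lemma dvdn_card_porbit (T : finType) (t : {perm T}) (x : T) (k : nat) :
  (t ^+ k) x = x -> #|porbit t x| %| k.
Proof.
set m := #|porbit t x| => fix_x.
have m_gt0 : 0 < m by rewrite lt0n card_porbit_neq0.
have fix_m : (t ^+ m) x = x by rewrite permX iter_porbit.
have fix_mq q : (t ^+ (m * q)) x = x.
  by rewrite expgM permX; elim: q => //= q ->.
have fix_mod : iter (k %% m) t x = x.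
  by rewrite -permX -{2}fix_x {2}(divn_eq k m) mulnC expgD permM fix_mq.
have := uniq_traject_porbit t x.
move/(nth_uniq x); rewrite size_traject -/m.
move/(_ (k %% m)%N 0%N (ltn_pmod _ m_gt0) m_gt0).
by rewrite !nth_traject ?ltn_pmod //= fix_mod eqxx => /esym.
Qed.

(** If s is the size of a cycle of t ^+ n inside C, then t ^+ (n * s) fixes a
point of C, so #|C| divides n * s and e divides s. *)
Lemma dvdn_card_stable_porbit (T : finType) (t : {perm T}) (n e : nat)
    (O C : {set T}) :
  (forall x, x \in O -> (t ^+ n) x \in O) -> C \in porbits t ->
  e %| #|C| -> coprime e n -> e %| #|O :&: C|.
Proof.
move=> stabO /imsetP[x0 _ ->] e_dvd co_en.
have acts_tn : [acts <[t ^+ n]>, on O :&: porbit t x0 | 'P].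
  rewrite cycle_subG !inE; apply/subsetP=> x; rewrite !inE => /andP[Ox Cx].
  by rewrite /= apermE stabO // porbit_sym porbit_perm porbit_sym.
rewrite -(acts_sum_card_orbit acts_tn); apply: dvdn_sum => D /imsetP[x].
rewrite in_setI -eq_porbit_mem => /andP[_ /eqP Dx] ->.
rewrite -porbitE; set s := #|_|.
have : (t ^+ (n * s)) x = x by rewrite expgM permX iter_porbit.
move/dvdn_card_porbit; rewrite Dx => /(dvdn_trans e_dvd).
by rewrite Gauss_dvdr.
Qed.

Lemma card_sum_porbits (T : finType) (t : {perm T}) (S : {set T}) :
  #|S| = \sum_(C in porbits t) #|S :&: C|.
Proof.
have part : partition (porbits t) [set: T].
  have -> : porbits t = orbit 'P <[t]> @: setT.
    by apply/setP=> C; apply/imsetP/imsetP=> -[x _ ->]; exists x; rewrite ?porbitE.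
  by apply: orbit_partition; apply/actsP=> ? _ ?; rewrite !inE.
rewrite -sum1_card big_mkcond (eq_bigl [in [set: T]]) /=; last first.
  by move=> x; rewrite inE.
rewrite (set_partition_big _ part) /=.
apply: eq_bigr => C _; rewrite -big_mkcondr sum1_card.
by apply: eq_card => x; rewrite !inE andbC.
Qed.

End Orbits.

(** * The additive translations of the permutation group *)

Section Translations.

(* Products of permutations are read from left to right: g * h is h o g. *)
Local Open Scope group_scope.

Variables (X : finType) (r : solution X).
Implicit Types (x y : X) (g h : {perm X}).

(** First component of the braid relation. *)
Lemma sigma_mul x y :
  sigma r y * sigma r x = sigma r (tau r y x) * sigma r (sigma r x y).
Proof.
apply/permP=> z; have := solution_braid r (x, y, z).
by rewrite /r12 /r23 !solutionE !permM => -[].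
Qed.

Lemma tau_sigma x y : tau r y x = (sigma r (sigma r x y))^-1 x.
Proof.
have := solution_invol r (x, y); rewrite !solutionE => -[eq_x _].
by apply: (@perm_inj _ (sigma r (sigma r x y))); rewrite permKV.
Qed.

(** The sum g + x in the additive group of the brace of permutations, extended
to all permutations g of X. *)
Definition add_gen x g : {perm X} := sigma r (g^-1 x) * g.

(** This recovers g^-1 x, and then g, from g + x; its iteration gives the powers
of the diagonal map. *)
Lemma add_genV x g : diag r ((add_gen x g)^-1 x) = g^-1 x.
Proof.
rewrite /add_gen invMg permM; set y := g^-1 x.
rewrite permE /diag_fun; apply: (@perm_inj _ (tau r ((sigma r y)^-1 y))).
by rewrite permKV tau_sigma permKV.
Qed.

Lemma add_gen_inj x : injective (add_gen x).
Proof.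
move=> g h eq_gh.
have eq_x : g^-1 x = h^-1 x by rewrite -(add_genV x g) eq_gh add_genV.
by move: eq_gh; rewrite /add_gen eq_x => /mulgI.
Qed.

Definition transl x : {perm {perm X}} := perm (@add_gen_inj x).

(** With u = g^-1 x and v = g^-1 y, both composites send g to a product p * g
where p depends on u and v only; the two values of p agree by [sigma_mul]
applied to u and sigma_u^-1 v. *)
Lemma transl_comm x y : commute (transl x) (transl y).
Proof.
apply/permP=> g; rewrite !permM !permE /add_gen !invMg !permM !mulgA.
congr (_ * g).
set u := g^-1 x; have := sigma_mul u ((sigma r u)^-1 (g^-1 y)).
by rewrite tau_sigma permKV.
Qed.

Definition rtransl h : {perm {perm X}} := perm (@mulIg _ h).

Lemma translJ x h : transl x ^ rtransl h = transl (h x).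
Proof.
apply/permP=> g; rewrite -{1}(mulgKV h g).
have -> : g * h^-1 * h = rtransl h (g * h^-1) by rewrite permE.
by rewrite permJ !permE /add_gen invMg invgK permM -mulgA mulgKV.
Qed.

(** The additive group of the brace, acting on Sym(X) by translations. *)
Definition transl_group : {group {perm {perm X}}} :=
  <<[set transl x | x : X]>>%G.

Lemma transl_group_abelian : abelian transl_group.
Proof.
rewrite abelian_gen; apply/centsP=> _ /imsetP[x _ ->] _ /imsetP[y _ ->].
exact: transl_comm.
Qed.

Lemma mem_transl x : transl x \in transl_group.
Proof. by rewrite mem_gen ?imset_f. Qed.

Lemma rtransl_norm h : rtransl h \in 'N(transl_group).
Proof.
rewrite (subsetP (norm_gen _)) // inE; apply/subsetP=> u /imsetP[t].
by case/imsetP=> x _ -> ->; rewrite translJ imset_f.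
Qed.

(** Right multiplication by h conjugates B to itself, so it maps the B-orbit of 1
to the B-orbit of h, which is the same orbit when h belongs to it. *)
Lemma orbit1_group_set (B : {group {perm {perm X}}}) :
  (forall h, rtransl h \in 'N(B)) -> group_set (orbit 'P B 1%g).
Proof.
move=> nBR; apply/group_setP; split; first exact: orbit_refl.
move=> _ h /orbitP[s Bs <-] Bh; rewrite /= apermE.
have -> : s 1 * h = (s ^ rtransl h) h.
  have Eh: rtransl h 1 = h by rewrite permE mul1g.
  by rewrite -{3}Eh permJ !permE.
by rewrite -apermE orbit_actr // memJ_norm.
Qed.

(** The orbit of 0 under all additive translations, that is, the
permutation group of the solution. *)
Definition perm_group : {group {perm X}} :=
  Group (orbit1_group_set rtransl_norm).

Lemma rtransl_norm_pcore (pi : nat_pred) h :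
  rtransl h \in 'N('O_pi(transl_group)).
Proof.
exact: (subsetP (char_norm_trans (pcore_char _ _) (subxx _))) (rtransl_norm h).
Qed.

(** The pi-component of the additive group of the brace, which is also a
subgroup for composition. *)
Definition hall_group (pi : nat_pred) : {group {perm X}} :=
  Group (orbit1_group_set (rtransl_norm_pcore pi)).

Lemma pcore_transl_Hall (pi : nat_pred) :
  pi.-Hall(transl_group) 'O_pi(transl_group).
Proof. exact/nilpotent_pcore_Hall/abelian_nil/transl_group_abelian. Qed.

(** [dvdn_card_orbit_Hall], for the abelian group of translations acting on
Sym(X), bounds the orbit of 1 from below. *)
Lemma hall_group_Hall (pi : nat_pred) : pi.-Hall(perm_group) (hall_group pi).
Proof.
have sQG : hall_group pi \subset perm_group.
  apply/subsetP=> g /orbitP[s Bs <-]; apply/orbitP; exists s => //.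
  exact: subsetP (pcore_sub _ _) s Bs.
have piQ : pi.-group (hall_group pi).
  by apply: pnat_dvd (dvdn_orbit _ _ _) (pcore_pgroup _ _).
rewrite pHallE sQG eqn_dvd -{1}(part_pnat_id piQ).
rewrite partn_dvd ?cardSg ?cardG_gt0 //=.
exact: dvdn_card_orbit_Hall (pcore_transl_Hall pi).
Qed.

Lemma sigma_perm_group x : sigma r x \in perm_group.
Proof.
apply/orbitP; exists (transl x); first exact: mem_transl.
by rewrite /= apermE permE /add_gen invg1 perm1 mulg1.
Qed.

(** The permutation (transl x ^+ k) 1 is the k-fold sum of x. *)
Lemma diag_translX x k : (diag r ^+ k) (((transl x ^+ k) 1)^-1 x) = x.
Proof.
elim: k => [|k IHk]; first by rewrite !expg0 !perm1 invg1 perm1.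
by rewrite expgS permM expgSr permM [transl x _]permE add_genV.
Qed.

(** With k the p-part of the order of the additive group, k-fold sums lie in its
p'-component; the inverse of the k-fold sum of y = T^k(x) sends y to a point
with the same image under T^k as x, hence to x. *)
Lemma diagX_hall_orbit (p : nat) x0 x :
  x \in orbit 'P (hall_group p^') x0 ->
  (diag r ^+ #|transl_group|`_p) x \in orbit 'P (hall_group p^') x0.
Proof.
set k := (#|transl_group|`_p)%N => Ox; set y := (diag r ^+ k) x.
rewrite orbit_sym -(orbit_transl _ Ox).
have := diag_translX y k; set g := (transl y ^+ k) 1 => Dy.
have {Dy} <- : g^-1 y = x by apply: (@perm_inj _ (diag r ^+ k)).
rewrite -apermE mem_orbit // groupV; apply: (@mem_orbit _ _ _ 'P).
rewrite (mem_Hall_pcore (pcore_transl_Hall _)) ?groupX ?mem_transl //.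
(* The power k kills the p-part of the translation by y. *)
have -> : transl y ^+ k = (transl y).`_p^' ^+ k.
  rewrite -{1}(consttC p (transl y)) expgMn; last exact: commuteX2.
  suff -> : (transl y).`_p ^+ k = 1 by rewrite mul1g.
  apply/eqP; rewrite -order_dvdn order_constt partn_dvd ?cardG_gt0 //.
  exact/order_dvdG/mem_transl.
exact/mem_p_elt/groupX/cycle_id/p_elt_constt.
Qed.

(** By [tau_sigma], tau_y x is also the image of x under an element of G, so r
preserves the square of a G-orbit and of its complement. *)
Lemma indecomposable_transitive (G : {group {perm X}}) x :
  indecomposable r -> (forall y, sigma r y \in G) -> orbit 'P G x = [set: X].
Proof.
move=> indec G_sigma; apply/eqP/contraT=> ntrans; case: indec.
have stab (b : bool) (S : {set X}) :
    (forall y, (y \in S) = ((y \in orbit 'P G x) == b)) ->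
  r @: setX S S = setX S S.
  move=> memS; have rS : r @: setX S S \subset setX S S.
    apply/subsetP=> _ /imsetP[[y z] /setXP[Sy Sz] ->].
    have GS g u : g \in G -> (g u \in S) = (u \in S).
      by move=> Gg; rewrite !memS -[g u]apermE orbit_actr.
    by rewrite solutionE inE tau_sigma !GS ?groupV // Sy Sz.
  apply/eqP; rewrite eqEcard rS card_imset ?leqnn //.
  exact: inv_inj (solution_invol r).
exists (orbit 'P G x), (~: orbit 'P G x); split.
- split; first by apply/set0Pn; exists x; apply: orbit_refl.
  by apply: contraNneq ntrans => C0; rewrite -[X in X == _]setCK C0 setC0.
- by rewrite disjoints_subset setCK.
- exact: setUCr.
- by apply: (stab true) => y; rewrite eqb_id.
- by apply: (stab false) => y; rewrite inE eqbF_neg.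
Qed.

(** The size of the orbit is odd, at most 2d, and divisible by the 2'-part d of
2d. *)
Lemma card_odd_hall_orbit d x :
  indecomposable r -> #|X| = (2 * d)%N -> odd d ->
  #|orbit 'P (hall_group 2^') x| = d.
Proof.
move=> indec cardX odd_d.
have odd_orbit : odd #|orbit 'P (hall_group 2^') x|.
  rewrite -[odd _]negbK -dvdn2 -p'natE //.
  have [_ odd_H _] := and3P (hall_group_Hall 2^').
  exact: pnat_dvd (dvdn_orbit _ _ _) odd_H.
have := dvdn_card_orbit_Hall 'P x (hall_group_Hall 2^').
rewrite (indecomposable_transitive x indec sigma_perm_group) cardsT cardX.
have d_gt0 : 0 < d by case: d odd_d {cardX}.
rewrite partnM // part_p'nat // mul1n part_pnat_id; last first.
  by rewrite p'natE // dvdn2 odd_d.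
have := max_card (orbit 'P (hall_group 2^') x).
rewrite cardX => le2d /dvdnP[q Dq]; move: odd_orbit le2d; rewrite Dq.
rewrite oddM => /andP[]; rewrite leq_pmul2r //.
by case: q {Dq} => [|[|[|q]]] //=; rewrite mul1n.
Qed.

End Translations.

(** * Splitting the three cycles of the diagonal map *)

Lemma perm_map_inv (S T : eqType) (x0 : S) (f : S -> T) (s : seq S) (t : seq T) :
  perm_eq (map f s) t -> exists2 s', perm_eq s s' & map f s' = t.
Proof.
rewrite perm_sym => /(perm_iotaP (f x0))[Is]; rewrite size_map => permIs ->.
exists (map (nth x0 s) Is).
  by rewrite -{1}[s](mkseq_nth x0) perm_sym perm_map.
rewrite -map_comp; apply/eq_in_map=> i; rewrite (perm_mem permIs) mem_iota /=.
by move=> lt_i; rewrite (nth_map x0).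
Qed.

Theorem theorem5 (X : finType) (r : solution X) (d a b c : nat) :
  indecomposable r ->
  #|X| = 2 * d ->
  odd d ->
  perm_eq (T_partition r) [:: 2 * a; b; c] ->
  0 < a -> 0 < b -> 0 < c ->
  coprime (2 * d) (a * b * c) ->
  b <= c ->
  2 * a + b = c.
Proof.
move=> indec cardX odd_d partT a_gt0 b_gt0 c_gt0 co_abc le_bc.
have [odd_a odd_b odd_c] : [/\ odd a, odd b & odd c].
  move: co_abc; rewrite coprimeMl => /andP[].
  by rewrite coprime2n !oddM -andbA => /and3P[].
have /card_gt0P[x0 _] : 0 < #|X| by apply: ltnW (solution_card r).
pose k := (#|transl_group r|`_2)%N.
pose O := orbit 'P (hall_group r 2^') x0.
have cardO : #|O| = d by apply: card_odd_hall_orbit.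
have stabO x : x \in O -> (diag r ^+ k)%g x \in O.
  exact: diagX_hall_orbit.
have co_k e : odd e -> coprime e k.
  move=> odd_e; rewrite coprime_sym.
  apply: (@pnat_coprime 2); first exact: part_pnat.
  by rewrite p'natE // dvdn2 odd_e.
pose n (C : {set X}) := #|O :&: C|.
have [C1 [C2 [C3 [permC []]]]] : exists C1, exists C2, exists C3,
    perm_eq (enum (porbits (diag r))) [:: C1; C2; C3] /\
    [/\ #|C1| = 2 * a, #|C2| = b & #|C3| = c].
  have [[|C1 [|C2 [|C3 [|? ?]]]] // permC [<- <- <-]] := perm_map_inv set0 partT.
  by exists C1, C2, C3.
move=> cardC1 cardC2 cardC3.
have PC C : (C \in porbits (diag r)) = (C \in [:: C1; C2; C3]).
  by rewrite -(perm_mem permC) mem_enum.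
have dvdO C e : C \in [:: C1; C2; C3] -> odd e -> e %| #|C| -> e %| n C.
  move=> PCC /co_k co_e dvd_e.
  by apply: dvdn_card_stable_porbit stabO _ dvd_e co_e; rewrite PC.
have sumC (S : {set X}) : #|S| = #|S :&: C1| + #|S :&: C2| + #|S :&: C3|.
  by rewrite (card_sum_porbits (diag r)) -big_enum (perm_big _ permC) !big_cons
    big_nil /= addn0 addnA.
have := sumC O; have := sumC setT; rewrite cardsT cardX cardO !setTI.
rewrite cardC1 cardC2 cardC3 -!/(n _).
have := subset_leq_card (subsetIr O C1); have := subset_leq_card (subsetIr O C2).
have := subset_leq_card (subsetIr O C3); rewrite cardC1 cardC2 cardC3 -!/(n _).
have /dvdnP[q1 ->] : a %| n C1 by apply: dvdO; rewrite ?inE ?eqxx ?cardC1 ?dvdn_mull.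
have /dvdnP[q2 ->] : b %| n C2 by apply: dvdO; rewrite ?inE ?eqxx ?cardC2 ?orbT.
have /dvdnP[q3 ->] : c %| n C3 by apply: dvdO; rewrite ?inE ?eqxx ?cardC3 ?orbT.
(* The remaining q1 <= 2 and q2, q3 <= 1 count the parts of sizes a, b and c
   that lie in O. *)
rewrite -{2}[c]mul1n -{2}[b]mul1n !leq_pmul2r //.
case: q3 => [|[|//]] _; case: q2 => [|[|//]] _; case: q1 => [|[|[|//]]] _; lia.
Qed.
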